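(* Let $(X,d)$ be a metric space with $d(x,y)\le 1$ for all $x,y\in X$, and let $H=H(X)$ be its Hausdorff space. Let $\mathbf{SeqTop}$ be the category of sequential topological spaces and continuous maps. Then $H$ represents the contravariant functor $\mathbf{SeqTop}^{\mathrm{op}} \to \mathbf{Sets}$ taking a sequential space $T$ to the set of closed subspaces $Z \subseteq T \times X$ for which the projection $\pi_1 : Z \to T$ is open and proper (and taking a continuous map $g:T'\to T$ to the pullback $Z\mapsto \{(t',x)\in T'\times X : (g(t'),x)\in Z\}$).
   Context: For a metric space $(X,d)$ with $d\le 1$, let $H=H(X)$ be the set of all compact subsets of $X$ (including $\emptyset$). For non-empty $A,B\in H$ put $$d_H(A,B) := \max\Big( \sup_{a \in A} \inf_{b \in B} d(a,b),\ \sup_{b \in B} \inf_{a \in A} d(a,b) \Big),$$ put $d_H(A,\emptyset)=d_H(\emptyset,A)=1$ for $A\neq\emptyset$, and $d_H(\emptyset,\emptyset)=0$. This is a metric on $H$; the topology it induces is the Hausdorff topology and $H$ with this topology is the Hausdorff space of $X$. A subset $Z$ of a topological space $T$ is sequentially closed if, whenever a sequence of points of $Z$ converges in $T$ to a point $t$, then $t\in Z$. A topological space is sequential if every sequentially closed subset is closed. (Metrizable spaces, such as $H$, are sequential.) The category $\mathbf{SeqTop}$ is the full subcategory of topological spaces on the sequential spaces. In the functor, $T\times X$ has the usual product topology. A continuous map is proper if it is closed and all of its fibers are compact (equivalently, universally closed). *)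

(* Defs.v *)
From HB Require Import structures.
From mathcomp Require Import all_boot all_order all_algebra.
From mathcomp Require Import all_classical all_reals all_analysis.

Set Implicit Arguments.
Unset Strict Implicit.
Unset Printing Implicit Defensive.

Import Order.TTheory GRing.Theory Num.Def Num.Theory.
Import numFieldNormedType.Exports.
Local Open Scope classical_set_scope.
Local Open Scope ring_scope.

(* [Type] plays the role of the category of sets; homs and values of
   presheaves are compared with Leibniz equality. *)
Record category := Category {
  cat_obj :> Type;
  homset : cat_obj -> cat_obj -> Type;
  cat_id : forall a, homset a a;
  cat_comp : forall a b c, homset b c -> homset a b -> homset a c;
  cat_comp1l : forall a b (f : homset a b), cat_comp (cat_id b) f = f;
  cat_comp1r : forall a b (f : homset a b), cat_comp f (cat_id a) = f;
  cat_compA : forall a b c d (h : homset c d) (g : homset b c) (f : homset a b),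
    cat_comp h (cat_comp g f) = cat_comp (cat_comp h g) f
}.

Record presheaf (C : category) := Presheaf {
  psh_obj :> C -> Type;
  psh_map : forall a b : C, homset a b -> psh_obj b -> psh_obj a;
  psh_map1 : forall (a : C) (z : psh_obj a), psh_map (cat_id a) z = z;
  psh_map_comp : forall (a b c : C) (g : homset b c) (f : homset a b) (z : psh_obj c),
    psh_map (cat_comp g f) z = psh_map f (psh_map g z)
}.

Definition represents (C : category) (h : C) (F : presheaf C) : Prop :=
  exists phi : forall a : C, homset a h -> F a,
    (forall a, bijective (phi a)) /\
    (forall (a b : C) (g : homset a b) (f : homset b h),
       phi a (cat_comp f g) = psh_map g (phi b f)).

Definition sequentially_closed (T : topologicalType) (Z : set T) : Prop :=
  forall (u : nat -> T) (t : T), (forall n, Z (u n)) -> u @ \oo --> t -> Z t.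

Definition sequential_space (T : topologicalType) : Prop :=
  forall Z : set T, sequentially_closed Z -> closed Z.

Record seqTopType := SeqTopType {
  seqTop_sort :> topologicalType;
  seqTopP : sequential_space seqTop_sort
}.

Definition SeqTop : category.
Proof.
refine (@Category seqTopType (fun S T => continuousType S T)
  (fun T => idfun) (fun S T U g f => g \o f) _ _ _) => *;
  exact/continuousEP.
Defined.

Lemma metric_sequential (R : realType) (M : metricType R) :
  sequential_space M.
Proof.
move=> Z Zseq p clZp.
have H n : exists z, Z z /\ mdist p z < n.+1%:R^-1.
  have [z [Zz bz]] := clZp _ (nbhsx_ballx p n.+1%:R^-1 ltac:(by rewrite invr_gt0)).
  by exists z; rewrite ballEmdist in bz.
pose u n := sval (cid (H n)).
have uP n : Z (u n) /\ mdist p (u n) < n.+1%:R^-1 by rewrite /u; case: cid.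
apply: (Zseq u) => [n|]; first by case: (uP n).
apply/metricType_numDomainType.cvgrPdist_lt => e e0.
near=> n; apply: lt_trans (uP n).2 _.
near: n; exact: near_infty_natSinv_lt (PosNum e0).
Unshelve. all: by end_near. Qed.

Definition set_dist (R : realType) (X : metricType R) (a : X) (B : set X) : R :=
  inf [set mdist a b | b in B].

Definition excess (R : realType) (X : metricType R) (A B : set X) : R :=
  sup [set set_dist a B | a in A].

(* [sup] and [inf] are real-valued; for nonempty sets they are genuine because
   the distance of [X] is bounded by [1] wherever this is used. *)
Definition hausdorff_dist (R : realType) (X : metricType R) (A B : set X) : R :=
  if A == set0 then (if B == set0 then 0 else 1)
  else if B == set0 then 1
  else maxr (excess A B) (excess B A).

(* The parameter [d_le1] is irrelevant to the points of the hyperspace, but the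
   metric structure exists only in its presence. *)
Record hyperspace (R : realType) (X : metricType R)
    (d_le1 : forall x y : X, mdist x y <= 1) := Hyperspace {
  hset :> set X;
  hset_compact : compact hset
}.

Lemma hyperspace_eq (R : realType) (X : metricType R)
    (d_le1 : forall x y : X, mdist x y <= 1) (A B : hyperspace d_le1) :
  hset A = hset B -> A = B.
Proof.
case: A B => [A cA] [B cB] /= AB; rewrite -AB in cB *.
by congr Hyperspace; exact: Prop_irrelevance.
Qed.

Lemma set_dist_le (R : realType) (X : metricType R) (a b : X) (B : set X) :
  B b -> set_dist a B <= mdist a b.
Proof.
move=> Bb; apply: ge_inf; last by exists b.
by exists 0 => _ [c _ <-]; exact: mdist_ge0.
Qed.

Lemma le_set_dist (R : realType) (X : metricType R) (a : X) (B : set X) r :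
  B !=set0 -> (forall b, B b -> r <= mdist a b) -> r <= set_dist a B.
Proof.
move=> [b Bb] rB; apply: lb_le_inf; first by exists (mdist a b), b.
by move=> _ [c Bc <-]; exact: rB.
Qed.

Lemma set_dist_le1 (R : realType) (X : metricType R)
    (d_le1 : forall x y : X, mdist x y <= 1) (a : X) (B : set X) :
  B !=set0 -> set_dist a B <= 1.
Proof. by move=> [b Bb]; exact: le_trans (set_dist_le _ Bb) _. Qed.

Lemma excess_ub (R : realType) (X : metricType R)
    (d_le1 : forall x y : X, mdist x y <= 1) (A B : set X) (a : X) :
  B !=set0 -> A a -> set_dist a B <= excess A B.
Proof.
move=> B0 Aa; apply: ub_le_sup; last by exists a.
by exists 1 => _ [c _ <-]; exact: set_dist_le1.
Qed.

Lemma excess_le (R : realType) (X : metricType R) (A B : set X) r :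
  A !=set0 -> (forall a, A a -> set_dist a B <= r) -> excess A B <= r.
Proof.
move=> [a Aa] Ar; apply: ge_sup; first by exists (set_dist a B), a.
by move=> _ [c Ac <-]; exact: Ar.
Qed.

Lemma excess_ge0 (R : realType) (X : metricType R)
    (d_le1 : forall x y : X, mdist x y <= 1) (A B : set X) :
  A !=set0 -> B !=set0 -> 0 <= excess A B.
Proof.
move=> [a Aa] B0; apply: le_trans (excess_ub d_le1 B0 Aa).
by apply: le_set_dist => // b _; exact: mdist_ge0.
Qed.

Lemma excess_triangle (R : realType) (X : metricType R)
    (d_le1 : forall x y : X, mdist x y <= 1) (A B C : set X) :
  A !=set0 -> B !=set0 -> C !=set0 ->
  excess A C <= excess A B + excess B C.
Proof.
move=> A0 B0 C0; apply: excess_le => // a Aa; rewrite -lerBlDr.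
apply: le_trans (excess_ub d_le1 B0 Aa); apply: le_set_dist => // b Bb.
rewrite lerBlDr -lerBlDl.
apply: le_trans (excess_ub d_le1 C0 Bb); apply: le_set_dist => // c Cc.
rewrite lerBlDl; apply: le_trans (metric_triangle a b c).
exact: set_dist_le.
Qed.

Lemma excess0_subset (R : realType) (X : metricType R)
    (d_le1 : forall x y : X, mdist x y <= 1) (A B : set X) :
  B !=set0 -> closed B -> excess A B <= 0 -> A `<=` B.
Proof.
move=> B0 cB e0 a Aa; apply: cB => V.
rewrite -nbhs_ballE => -[e /= egt0 eV].
have aB0 : set_dist a B <= 0 by exact: le_trans (excess_ub d_le1 B0 Aa) e0.
apply: contrapT => H; have : e <= set_dist a B.
  apply: le_set_dist => // b Bb; rewrite leNgt; apply/negP => abe.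
  by apply: H; exists b; split => //; apply: eV; rewrite ballEmdist.
by move=> /le_trans/(_ aB0); rewrite leNgt egt0.
Qed.

Lemma hausdorff_distxx (R : realType) (X : metricType R)
    (d_le1 : forall x y : X, mdist x y <= 1) (A : set X) :
  hausdorff_dist A A = 0.
Proof.
rewrite /hausdorff_dist; case: eqVneq => // /set0P A0; rewrite maxxx.
apply/eqP; rewrite eq_le excess_ge0// andbT; apply: excess_le => // a Aa.
by rewrite (le_trans (set_dist_le a Aa))// mdistxx.
Qed.

Lemma hausdorff_dist_sym (R : realType) (X : metricType R) (A B : set X) :
  hausdorff_dist A B = hausdorff_dist B A.
Proof. by rewrite /hausdorff_dist; do 2 case: eqVneq => //; rewrite maxC. Qed.

Lemma hausdorff_dist_positivity (R : realType) (X : metricType R)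
    (d_le1 : forall x y : X, mdist x y <= 1) (A B : hyperspace d_le1) :
  hausdorff_dist A B = 0 -> A = B.
Proof.
have cl (C : hyperspace d_le1) : closed C.
  by apply: compact_closed; [exact: metric_hausdorff|exact: hset_compact].
move=> AB; apply: hyperspace_eq; move: AB; rewrite /hausdorff_dist.
case: eqVneq => [->|/set0P A0].
  by case: eqVneq => [->//|_ /eqP]; rewrite oner_eq0.
case: eqVneq => [_ /eqP|/set0P B0 m0]; first by rewrite oner_eq0.
apply/seteqP; split; apply: (excess0_subset d_le1) => //;
  by rewrite -m0 le_max lexx ?orbT.
Qed.

Lemma hausdorff_dist_triangle (R : realType) (X : metricType R)
    (d_le1 : forall x y : X, mdist x y <= 1) (B A C : set X) :
  hausdorff_dist A C <= hausdorff_dist A B + hausdorff_dist B C.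
Proof.
have le1 (D E : set X) : D !=set0 -> E !=set0 -> excess D E <= 1.
  by move=> D0 E0; apply: excess_le => // a _; exact: set_dist_le1.
rewrite /hausdorff_dist.
case: (eqVneq A) => [_|/set0P A0]; case: (eqVneq B) => [_|/set0P B0];
  case: (eqVneq C) => [_|/set0P C0];
  rewrite ?addr0 ?add0r ?ler01 ?lexx ?addr_ge0 ?ler01//.
- by rewrite lerDl le_max excess_ge0.
- by rewrite ge_max !(le_trans (le1 _ _ _ _))// lerDl ler01.
- by rewrite lerDr le_max excess_ge0.
- rewrite ge_max; apply/andP; split.
    apply: le_trans (excess_triangle d_le1 A0 B0 C0) _.
    by apply: lerD; rewrite le_max lexx.
  apply: le_trans (excess_triangle d_le1 C0 B0 A0) _.
  by rewrite addrC; apply: lerD; rewrite le_max lexx orbT.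
Qed.

HB.instance Definition _ (R : realType) (X : metricType R)
    (d_le1 : forall x y : X, mdist x y <= 1) :=
  gen_eqMixin (hyperspace d_le1).
HB.instance Definition _ (R : realType) (X : metricType R)
    (d_le1 : forall x y : X, mdist x y <= 1) :=
  gen_choiceMixin (hyperspace d_le1).

HB.instance Definition _ (R : realType) (X : metricType R)
    (d_le1 : forall x y : X, mdist x y <= 1) :=
  @isMetric.Build R (hyperspace d_le1)
    (fun A B => hausdorff_dist A B)
    (fun A => hausdorff_distxx d_le1 A)
    (@hausdorff_dist_positivity R X d_le1)
    (fun A B => hausdorff_dist_sym A B)
    (fun B A C => hausdorff_dist_triangle d_le1 B A C).

Definition hausdorff_space_of (R : realType) (X : metricType R)
    (d_le1 : forall x y : X, mdist x y <= 1) : SeqTop :=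
  @SeqTopType (hyperspace d_le1) (@metric_sequential R (hyperspace d_le1)).

Definition open_map (S T : topologicalType) (f : S -> T) : Prop :=
  forall U : set S, open U -> open (f @` U).

Definition closed_map (S T : topologicalType) (f : S -> T) : Prop :=
  forall C : set S, closed C -> closed (f @` C).

Definition proper_map (S T : topologicalType) (f : S -> T) : Prop :=
  [/\ continuous f, closed_map f & forall t, compact (f @^-1` [set t])].

(* [set_type Z] carries the subspace topology of the product [T * X]. *)
Definition proj1_on (T X : topologicalType) (Z : set (T * X)) :
    set_type Z -> T :=
  fun z => (set_val z).1.

Definition open_proper_family (T X : topologicalType) (Z : set (T * X)) : Prop :=
  [/\ closed Z, open_map (@proj1_on T X Z) & proper_map (@proj1_on T X Z)].

Definition pullback (S T X : topologicalType) (g : S -> T) (Z : set (T * X)) :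
    set (S * X) :=
  [set p | Z (g p.1, p.2)].

Lemma proj1_on_continuous (T X : topologicalType) (Z : set (T * X)) :
  continuous (@proj1_on T X Z).
Proof.
move=> z; apply: (@continuous_comp _ _ _ set_val fst); last exact: cvg_fst.
exact: initial_continuous.
Qed.

Lemma proj2_continuous (T X : topologicalType) (Z : set (T * X)) :
  continuous (fun z : set_type Z => (set_val z).2).
Proof.
move=> z; apply: (@continuous_comp _ _ _ set_val snd); last exact: cvg_snd.
exact: initial_continuous.
Qed.

Lemma pullback_closed (S T X : topologicalType) (g : S -> T)
    (Z : set (T * X)) :
  continuous g -> closed Z -> closed (pullback g Z).
Proof.
move=> cg; apply: (preimage_closed (f := fun p : S * X => (g p.1, p.2))) => p _.
apply: cvg_pair; last exact: cvg_snd.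
by apply: (continuous_comp (@cvg_fst _ _ _ _ _)); exact: cg.
Qed.

Lemma pullback_open (S T X : topologicalType) (g : S -> T)
    (Z : set (T * X)) :
  continuous g -> open_map (@proj1_on T X Z) ->
  open_map (@proj1_on S X (pullback g Z)).
Proof.
move=> cg oZ _ [W oW <-]; rewrite openE => _ [[[s x] /= Zsx] Wsx <-].
rewrite /proj1_on /= in Wsx *; move/set_mem: (Zsx) => Zgx.
have : nbhs (s, x) W by apply: open_nbhs_nbhs; split.
case=> -[A B] /= [nA nB] ABW.
pose U := (fun z : set_type Z => (set_val z).2) @^-1` B°.
have oU : open U.
  by apply: open_comp => [z _|]; [exact: proj2_continuous|exact: open_interior].
have nU : nbhs (g s) (@proj1_on T X Z @` U).
  apply: open_nbhs_nbhs; split; first exact: oZ.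
  by exists (exist _ (g s, x) (mem_set Zgx)).
near=> s'.
have : (@proj1_on T X Z @` U) (g s') by near: s'; exact: cg.
case=> -[[t y] Zty] /= By ts; rewrite /proj1_on /= in ts.
move/set_mem: (Zty); rewrite ts => Zy.
exists (exist _ (s', y) (mem_set (Zy : pullback g Z (s', y)))) => //.
apply: ABW; split => /=; first by near: s'.
exact: interior_subset.
Unshelve. all: by end_near. Qed.

Lemma fiber_compact (T X : topologicalType) (Z : set (T * X)) (t : T) :
  compact (@proj1_on T X Z @^-1` [set t]) -> compact [set x | Z (t, x)].
Proof.
move=> cK; have -> : [set x | Z (t, x)] =
    (fun z : set_type Z => (set_val z).2) @` (@proj1_on T X Z @^-1` [set t]).
  apply/seteqP; split=> [x /= Zx|_ [[[s y] Zsy] /= st <-]].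
    by exists (exist _ (t, x) (mem_set Zx)).
  by rewrite -st; exact/set_mem.
apply: continuous_compact => //; apply: continuous_subspaceT.
exact: proj2_continuous.
Qed.

Lemma compact_fiber (T X : topologicalType) (Z : set (T * X)) (t : T) :
  compact [set x | Z (t, x)] -> compact (@proj1_on T X Z @^-1` [set t]).
Proof.
move=> cK F PF Ft.
have c : compact ([set t] `*` [set x | Z (t, x)]).
  by apply: compact_setX => //; exact: compact_set1.
have Fc : F (set_val @^-1` ([set t] `*` [set x | Z (t, x)])).
  apply: filterS Ft => -[[s y] Zsy] /= st; split => //=.
  by rewrite -st; exact/set_mem.
have [[s x] [[/= -> {s} Zx] clx]] := c _ (fmap_proper_filter _ PF) Fc.
exists (exist _ (t, x) (mem_set Zx)); split => // A B FA.
rewrite nbhsE => -[_ [[W oW <-] Wx] WB].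
have FA' : F (set_val @^-1` (set_val @` A)).
  by apply: filterS FA => z Az; exists z.
have nW : nbhs (t, x) W by apply: open_nbhs_nbhs.
have [p [[z Az zp] Wp]] := clx (set_val @` A) W FA' nW.
by exists z; split => //; apply: WB; rewrite /= zp.
Qed.

Lemma pullback_proper (R : realType) (X : metricType R)
    (S T : topologicalType) (g : S -> T) (Z : set (T * X)) :
  continuous g -> proper_map (@proj1_on T X Z) ->
  proper_map (@proj1_on S X (pullback g Z)).
Proof.
move=> cg [_ clZ kZ]; split; first exact: proj1_on_continuous.
- move=> C clC; rewrite -openC; rewrite openE => s sC.
  have [D oD DC] : open (~` C) by rewrite openC.
  have DE p (h : pullback g Z p) : D p <-> ~ C (exist _ p (mem_set h)).
    by have := congr1 (fun B : set _ => B (exist _ p (mem_set h))) DC => /= ->.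
  have /compact_near_coveringP kK := fiber_compact (kZ (g s)).
  have : \forall i \near filter_prod (nbhs s) (0^'+ : set_system R),
      [set x | Z (g s, x)] `<=` (fun x => forall y, ball x i.2 y -> D (i.1, y)).
    apply: (kK _ _ (fun i x => forall y, ball x i.2 y -> D (i.1, y))) => x Zx.
    have Dx : D (s, x).
      apply/(DE (s, x) Zx) => Cx; apply: sC.
      by exists (exist _ (s, x) (mem_set (Zx : pullback g Z (s, x)))).
    have : nbhs (s, x) D by apply: open_nbhs_nbhs.
    case=> -[A B] /= [nA]; rewrite -nbhs_ballE => -[e /= e0 eB] ABD.
    exists (ball x (e / 2), A `*` [set r | r < e / 2]) => /=.
      split; first by apply: nbhsx_ballx; rewrite divr_gt0.
      exists (A, [set r | r < e / 2]) => //=; split => //.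
      by apply: nbhs_right_lt; rewrite divr_gt0.
    move=> [x' [s' r]] /= [bx' [As' re]] y bxy; apply: ABD; split => //=.
    apply: eB; rewrite (splitr e); apply: ball_triangle bx' _.
    exact: le_ball (ltW re) _ bxy.
  case=> -[A E] /= [nA nE] AE.
  have [e [e0 Ee]] : exists e : R, 0 < e /\ E e.
    have : \forall e \near (0 : R)^'+, 0 < e /\ E e.
      by near=> e; split; near: e => //; exact: nbhs_right_gt.
    by move=> /filter_ex.
  pose V := \bigcup_(x in [set x | Z (g s, x)]) (ball x e)°.
  have oV : open V by apply: bigcup_open => x _; exact: open_interior.
  pose N := (fun z : set_type Z => (set_val z).2) @^-1` (~` V).
  have clN : closed N.
    apply: preimage_closed => [z _|]; first exact: proj2_continuous.
    by rewrite closedC.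
  have nW : nbhs (g s) (~` (@proj1_on T X Z @` N)).
    apply: open_nbhs_nbhs; split; first by rewrite openC; exact: clZ.
    move=> [[[t x] Ztx] /= nV ts]; apply: nV; exists x => /=.
      by rewrite -ts; exact/set_mem.
    exact: nbhsx_ballx.
  near=> s'; move=> [[[s'' x] h] Cx /= s's]; rewrite /proj1_on /= in s's.
  subst s''; move/set_mem: (h) => h'.
  have Vx : V x.
    apply: contrapT => nVx.
    have : (~` (@proj1_on T X Z @` N)) (g s').
      by near: s'; exact: cg.
    by apply; exists (exist _ (g s', x) (mem_set h')).
  have [x0 Zx0 /interior_subset bx] := Vx.
  have : D (s', x).
    by apply: (AE (s', e) _ x0 Zx0 x bx); split => //=; near: s'.
  by move/(DE _ h'); apply; rewrite (Prop_irrelevance (mem_set h') h).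
- by move=> s; apply: compact_fiber; exact: fiber_compact (kZ (g s)).
Unshelve. all: by end_near. Qed.

Lemma pullback_family (R : realType) (X : metricType R)
    (S T : topologicalType) (g : continuousType S T) (Z : set (T * X)) :
  open_proper_family Z -> open_proper_family (pullback g Z).
Proof.
move=> [cZ oZ pZ]; have cg : continuous g by exact: cts_fun.
split; [exact: pullback_closed|exact: pullback_open|exact: pullback_proper].
Qed.

Definition open_proper_families (R : realType) (X : metricType R) : presheaf SeqTop.
Proof.
refine (@Presheaf SeqTop (fun T : seqTopType => {Z : set (T * X) | open_proper_family Z})
  (fun (S T : seqTopType) (g : continuousType S T) Z =>
     exist _ (pullback g (sval Z)) (pullback_family g (svalP Z))) _ _).
- by move=> T [Z fZ]; apply: eq_exist => /=; apply/seteqP; split => -[].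
- by move=> S T U g f [Z fZ]; exact: eq_exist.
Defined.

(* Main.v *)
Require Import Defs.
From HB Require Import structures.
From mathcomp Require Import all_boot all_order all_algebra.
From mathcomp Require Import all_classical all_reals all_analysis.

(** The hyperspace carries a universal family: the set of pairs [(A, x)] with
    [x] in [A], whose fiber over [A] is [A] itself.  Once this tautological
    family is known to be closed, open and proper over the hyperspace
    ([tautological_family_open_proper]), pulling it back along a map into the
    hyperspace is a natural transformation from maps to families, because a
    family pulled back from an open proper one is open and proper.  It remains
    to invert it.  A family [Z] over [T] can only come from the map sending [t]
    to its fiber [Z_t], a compact set, so everything rests on the continuity of
    this map ([family_fiber_continuous]).

    Both halves compare the Hausdorff distance with its two one-sided parts,
    in opposite directions ([mdist_hyperspace_lt], [mdist_hyperspace_le]).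
    In the second half, that [Z_s] stays in a small neighbourhood of [Z_t] for
    [s] near [t] comes from the closedness of the projection
    ([fiber_upper_semicontinuous]); that every point of [Z_t] is approached by
    points of [Z_s] comes from its openness ([fiber_lower_semicontinuous]), and
    compactness of [Z_t] makes the approximation uniform.

    The empty set is at distance 1 from every other point of the hyperspace.
    Consequently a bound [mdist A B < e] can be unfolded into statements about
    points only when [e <= 1], and the radii of the balls taken in the
    hyperspace are cut off at 1. *)

Import Order.TTheory GRing.Theory Num.Def Num.Theory.
Import numFieldNormedType.Exports.

Local Open Scope classical_set_scope.
Local Open Scope ring_scope.

Lemma set_dist_lt {R : realType} {X : metricType R} {B : set X} {a : X} {e : R} :
  B !=set0 -> set_dist a B < e -> exists2 b, B b & mdist a b < e.
Proof.
move=> [b Bb] /inf_lt[|_ [c Bc <-] ace]; last by exists c.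
by exists (mdist a b), b.
Qed.

(** For [e > 1] the conclusion fails: the empty set is at distance [1 < e] from
    a nonempty [A], yet no point of the empty set is close to a point of [A]. *)
Lemma mdist_hyperspace_lt {R : realType} {X : metricType R}
    {d_le1 : forall x y : X, mdist x y <= 1} {A B : hyperspace d_le1} {e : R} :
  e <= 1 -> mdist A B < e ->
  (forall a, hset A a -> exists2 b, hset B b & mdist a b < e) /\
  (forall b, hset B b -> exists2 a, hset A a & mdist a b < e).
Proof.
move=> e1; have -> : mdist A B = hausdorff_dist A B by [].
rewrite /hausdorff_dist.
case: (eqVneq (hset A)) => [A0|/set0P A0]; case: (eqVneq (hset B)) => [B0|/set0P B0].
- by rewrite A0 B0; split.
- by rewrite ltNge e1.
- by rewrite ltNge e1.
rewrite gt_max => /andP[AB BA]; split=> [a Aa|b Bb].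
  by apply: set_dist_lt => //; exact: le_lt_trans (excess_ub d_le1 B0 Aa) AB.
have [||a Aa bae] := @set_dist_lt _ _ A b e => //.
  exact: le_lt_trans (excess_ub d_le1 A0 Bb) BA.
by exists a => //; rewrite metric_sym.
Qed.

(** Here [e] may exceed 1, since the two approximation hypotheses force [A] and
    [B] to be both empty or both nonempty. *)
Lemma mdist_hyperspace_le {R : realType} {X : metricType R}
    {d_le1 : forall x y : X, mdist x y <= 1} (A B : hyperspace d_le1) (e : R) :
  0 <= e ->
  (forall a, hset A a -> exists2 b, hset B b & mdist a b <= e) ->
  (forall b, hset B b -> exists2 a, hset A a & mdist a b <= e) ->
  mdist A B <= e.
Proof.
move=> e0 AB BA; have -> : mdist A B = hausdorff_dist A B by [].
rewrite /hausdorff_dist.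
case: (eqVneq (hset A)) => [A0|/set0P A0]; case: (eqVneq (hset B)) => [B0|/set0P B0] //.
- by have [b /BA[a]] := B0; rewrite A0.
- by have [a /AB[b]] := A0; rewrite B0.
rewrite ge_max; apply/andP; split; apply: excess_le => //.
  by move=> a /AB[b Bb]; exact: le_trans (set_dist_le _ Bb).
move=> b /BA[a Aa ab].
by apply: le_trans (set_dist_le _ Aa) _; rewrite metric_sym.
Qed.

Definition tautological_family {R : realType} {X : metricType R}
    (d_le1 : forall x y : X, mdist x y <= 1) : set (hyperspace d_le1 * X) :=
  [set p | hset p.1 p.2].

Lemma nbhs_hyperspace_prod {R : realType} {X : metricType R}
    {d_le1 : forall x y : X, mdist x y <= 1}
    {A : hyperspace d_le1} {x : X} {W : set (hyperspace d_le1 * X)} :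
  nbhs (A, x) W -> exists e : R, [/\ 0 < e, e <= 1 &
    forall B y, mdist A B < e -> mdist x y < e -> W (B, y)].
Proof.
case=> -[U V] /= []; rewrite -!nbhs_ballE => -[r /= r0 rU] [s /= s0 sV] UVW.
exists (minr 1 (minr r s)); split.
- by rewrite !lt_min ltr01 r0 s0.
- by rewrite ge_min lexx.
move=> B y; rewrite !lt_min => /and3P[_ AB _] /and3P[_ _ xy].
by apply: UVW; split => /=; [apply: rU|apply: sV]; rewrite ballEmdist.
Qed.

Lemma nbhs_hyperspace_mdist {R : realType} {X : metricType R}
    {d_le1 : forall x y : X, mdist x y <= 1} (A : hyperspace d_le1) (e : R) :
  0 < e -> nbhs A [set B : hyperspace d_le1 | mdist A B < e].
Proof. by move=> e0; have := nbhsx_ballx A e e0; rewrite ballEmdist. Qed.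

(** If [(B, y)] is close to [(A, x)] with [y] in [B], then [y] is close to a
    point of [A], and hence so is [x]; compact sets are closed in a metric
    space. *)
Lemma tautological_family_closed {R : realType} {X : metricType R}
    (d_le1 : forall x y : X, mdist x y <= 1) :
  closed (tautological_family d_le1).
Proof.
move=> [A x] clAx.
have clA : closed A.
  by apply: compact_closed; [exact: metric_hausdorff|exact: hset_compact].
apply: clA => V; rewrite -nbhs_ballE => -[e /= e0 eV].
pose r := minr 1 (e / 2).
have r0 : 0 < r by rewrite lt_min ltr01 divr_gt0.
have nW : nbhs (A, x) ([set B : hyperspace d_le1 | mdist A B < r] `*`
                      [set y | mdist x y < r]).
  exists ([set B : hyperspace d_le1 | mdist A B < r], [set y | mdist x y < r]) => //.
  split => /=; first exact: nbhs_hyperspace_mdist.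
  by have := nbhsx_ballx x r r0; rewrite ballEmdist.
have [[B y] [/= By [/= AB xy]]] := clAx _ nW.
have r1 : r <= 1 by rewrite ge_min lexx.
have [_ /(_ y By)[a Aa ay]] := mdist_hyperspace_lt r1 AB.
exists a; split => //; apply: eV; rewrite ballEmdist /=.
apply: le_lt_trans (metric_triangle x y a) _; rewrite (splitr e) (metric_sym y a).
have re : r <= e / 2 by rewrite ge_min lexx orbT.
by apply: ltrD; [exact: lt_le_trans xy re|exact: lt_le_trans ay re].
Qed.

(** A point [x] of [A] is approximated, in every [B] close to [A], by a point
    of [B]: the fiber over each such [B] meets any given neighbourhood of [x]. *)
Lemma tautological_family_open {R : realType} {X : metricType R}
    (d_le1 : forall x y : X, mdist x y <= 1) :
  open_map (proj1_on (Z := tautological_family d_le1)).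
Proof.
move=> _ [W oW <-]; rewrite openE => _ [[[A x] Ax] /= WAx <-].
have [e [e0 e1 eW]] : exists e : R, [/\ 0 < e, e <= 1 &
    forall (B : hyperspace d_le1) y, mdist A B < e -> mdist x y < e -> W (B, y)].
  by apply: nbhs_hyperspace_prod; exact: open_nbhs_nbhs.
apply: filterS (nbhs_hyperspace_mdist A e e0) => B AB.
have [/(_ x (set_mem Ax))[b Bb xb] _] := mdist_hyperspace_lt e1 AB.
have Zb : tautological_family d_le1 (B, b) by [].
by exists (exist _ (B, b) (mem_set Zb)) => //; exact: eW.
Qed.

(** A tube lemma.  If the closed set [C] has no point over [A], each [(A, x)]
    with [x] in [A] has a neighbourhood free of [C], and compactness of [A]
    provides one radius [e] good for all [x] at once.  When [B] is within [e]
    of [A], every point of [B] is within [e] of some such [x], so [C] has no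
    point over [B]. *)
Lemma tautological_family_closed_map {R : realType} {X : metricType R}
    (d_le1 : forall x y : X, mdist x y <= 1) :
  closed_map (proj1_on (Z := tautological_family d_le1)).
Proof.
move=> C /closed_openC[D oD DC]; rewrite -openC openE => A AC.
have DE p (Zp : p \in tautological_family d_le1) :
    D p <-> ~ C (exist _ p Zp).
  by have := congr1 (fun S : set _ => S (exist _ p Zp)) DC => /= ->.
have /compact_near_coveringP cA := @hset_compact _ _ _ A.
have : \forall e \near (0 : R)^'+, hset A `<=` (fun x =>
    forall B y, mdist A B < e -> mdist x y < e -> D (B, y)).
  apply: (cA _ _ (fun e x => forall B y, mdist A B < e -> mdist x y < e -> D (B, y))).
  move=> x Ax.
  have ZAx : tautological_family d_le1 (A, x) by [].
  have DAx : D (A, x).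
    apply/(DE _ (mem_set ZAx)) => CAx; apply: AC.
    by exists (exist _ (A, x) (mem_set ZAx)).
  have [e [e0 _ eD]] := nbhs_hyperspace_prod (open_nbhs_nbhs (conj oD DAx)).
  (* If the radius [e] works at [x], then every radius below [e / 2] works at
     every [x'] within [e / 2] of [x]. *)
  exists ([set x' | mdist x x' < e / 2], [set r | r < e / 2]).
    split => /=; last by apply: nbhs_right_lt; rewrite divr_gt0.
    by have := nbhsx_ballx x (e / 2); rewrite ballEmdist; apply; rewrite divr_gt0.
  move=> [x' r] [/= xx' re] B y AB x'y.
  apply: eD.
    by apply: lt_trans AB (lt_trans re _); rewrite ltr_pdivrMr// ltr_pMr// ltr1n.
  apply: le_lt_trans (metric_triangle x x' y) _; rewrite (splitr e).
  by apply: ltrD => //; exact: lt_trans x'y re.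
move=> eA.
have [e [e0 e1 eD]] : exists e : R, [/\ 0 < e, e <= 1 & hset A `<=` (fun x =>
    forall B y, mdist A B < e -> mdist x y < e -> D (B, y))].
  have : \forall e \near (0 : R)^'+, [/\ 0 < e, e <= 1 & hset A `<=` (fun x =>
    forall B y, mdist A B < e -> mdist x y < e -> D (B, y))].
    by near=> e; split; near: e => //; [exact: nbhs_right_gt|exact: nbhs_right_le].
  by move=> /filter_ex.
apply: filterS (nbhs_hyperspace_mdist A e e0) => B AB.
move=> [[[B' y] ZBy] CBy]; rewrite /proj1_on/= => B'B; subst B'.
have [_ /(_ y (set_mem ZBy))[a Aa ay]] := mdist_hyperspace_lt e1 AB.
by have /DE := eD a Aa B y AB ay; exact.
Unshelve. all: by end_near. Qed.

Lemma tautological_family_open_proper {R : realType} {X : metricType R}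
    (d_le1 : forall x y : X, mdist x y <= 1) :
  open_proper_family (tautological_family d_le1).
Proof.
split; [exact: tautological_family_closed|exact: tautological_family_open|].
split; [exact: proj1_on_continuous|exact: tautological_family_closed_map|].
by move=> A; apply: compact_fiber; exact: (@hset_compact _ _ _ A).
Qed.

Definition family_fiber {R : realType} {X : metricType R}
    (d_le1 : forall x y : X, mdist x y <= 1) {T : topologicalType}
    (Z : {Z : set (T * X) | open_proper_family Z}) (t : T) : hyperspace d_le1 :=
  let: And3 _ _ (And3 _ _ kZ) := svalP Z in
  Hyperspace d_le1 (fiber_compact (kZ t)).

Lemma family_fiberE {R : realType} {X : metricType R}
    (d_le1 : forall x y : X, mdist x y <= 1) {T : topologicalType}
    (Z : {Z : set (T * X) | open_proper_family Z}) (t : T) :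
  hset (family_fiber d_le1 Z t) = [set x | sval Z (t, x)].
Proof. by rewrite /family_fiber; case: (svalP Z) => ? ? []. Qed.

(** The points of [Z] lying over [~` V] form a closed set; its image in [T] is
    closed and misses [t]. *)
Lemma fiber_upper_semicontinuous {T X : topologicalType} (Z : set (T * X))
    (t : T) (V : set X) :
  closed_map (proj1_on (Z := Z)) -> open V -> (forall x, Z (t, x) -> V x) ->
  \forall s \near t, forall x, Z (s, x) -> V x.
Proof.
move=> clZ oV tV.
pose N := (fun z : set_type Z => (set_val z).2) @^-1` (~` V).
have clN : closed N.
  apply: preimage_closed => [z _|]; first exact: proj2_continuous.
  by rewrite closedC.
have : nbhs t (~` (proj1_on (Z := Z) @` N)).
  apply: open_nbhs_nbhs; split; first by rewrite openC; exact: clZ.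
  move=> [[[s x] Zsx] /= nV st]; apply: nV; apply: tV => /=.
  by rewrite -st; exact/set_mem.
apply: filterS => s sN x Zsx; apply: contrapT => nVx; apply: sN.
by exists (exist _ (s, x) (mem_set Zsx)).
Qed.

(** The points of [Z] lying over [V] form an open set, whose image in [T] is a
    neighbourhood of [t]. *)
Lemma fiber_lower_semicontinuous {T X : topologicalType} (Z : set (T * X))
    (t : T) (x : X) (V : set X) :
  open_map (proj1_on (Z := Z)) -> open V -> Z (t, x) -> V x ->
  \forall s \near t, exists2 y, Z (s, y) & V y.
Proof.
move=> oZ oV Ztx Vx.
pose N := (fun z : set_type Z => (set_val z).2) @^-1` V.
have oN : open N by apply: open_comp => // z _; exact: proj2_continuous.
have : nbhs t (proj1_on (Z := Z) @` N).
  apply: open_nbhs_nbhs; split; first exact: oZ.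
  by exists (exist _ (t, x) (mem_set Ztx)).
apply: filterS => _ [[[s y] Zsy] /= Vy <-].
by exists y => //; exact/set_mem.
Qed.

(** Upper and lower semicontinuity bound the two one-sided distances between
    the fibers over [s] and over [t].  Lower semicontinuity speaks of one point
    of the fiber over [t] at a time, and compactness of this fiber makes it
    uniform: the points of nearby fibers found within [e / 2] of [x] serve
    every [x'] within [e / 2] of [x]. *)
Lemma family_fiber_continuous {R : realType} {X : metricType R}
    (d_le1 : forall x y : X, mdist x y <= 1) {T : topologicalType}
    (Z : {Z : set (T * X) | open_proper_family Z}) :
  continuous (family_fiber d_le1 Z).
Proof.
move=> t; apply/metricType_numDomainType.cvgrPdist_le => e e0.
have [_ oZ [_ clZ kZ]] := svalP Z.
have upper : \forall s \near t, forall y, sval Z (s, y) ->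
    exists2 x, sval Z (t, x) & mdist x y <= e.
  pose V := \bigcup_(x in [set x | sval Z (t, x)]) (ball x e)°.
  have oV : open V by apply: bigcup_open => x _; exact: open_interior.
  have tV x : sval Z (t, x) -> V x by move=> Zx; exists x => //; exact: nbhsx_ballx.
  apply: filterS (fiber_upper_semicontinuous _ _ _ clZ oV tV) => s sV y /sV[x Zx].
  move=> /interior_subset; rewrite ballEmdist => xy.
  by exists x => //; exact: ltW.
have lower : \forall s \near t, [set x | sval Z (t, x)] `<=`
    (fun x => exists2 y, sval Z (s, y) & mdist x y <= e).
  have /compact_near_coveringP kZt := fiber_compact (kZ t).
  apply: (kZt _ _ (fun s x => exists2 y, sval Z (s, y) & mdist x y <= e)) => x Zx.
  have e20 : 0 < e / 2 by rewrite divr_gt0.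
  exists ((ball x (e / 2))°, [set s | exists2 y, sval Z (s, y) & (ball x (e / 2))° y]).
    split => /=; first by apply: nbhs_interior; exact: nbhsx_ballx.
    apply: fiber_lower_semicontinuous oZ _ Zx _; first exact: open_interior.
    exact: nbhsx_ballx.
  move=> [x' s] [/= /interior_subset xx' [y Zy /interior_subset xy]].
  exists y => //; rewrite !ballEmdist/= in xx' xy.
  apply: le_trans (metric_triangle x' x y) _; rewrite (splitr e) metric_sym.
  by apply: lerD; exact: ltW.
near=> s; apply: mdist_hyperspace_le; first exact: ltW.
- by move=> x; rewrite !family_fiberE; move: x; near: s.
- by move=> y; rewrite !family_fiberE; move: y; near: s.
Unshelve. all: by end_near. Qed.

Theorem theorem2 (R : realType) (X : metricType R)
    (d_le1 : forall x y : X, mdist x y <= 1) :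
  represents (hausdorff_space_of d_le1) (open_proper_families X).
Proof.
pose taut := exist _ _ (tautological_family_open_proper d_le1)
  : open_proper_families X (hausdorff_space_of d_le1).
exists (fun T f => psh_map f taut); split; last first.
  by move=> S T g f; exact: (psh_map_comp f g taut).
move=> T.
pose classify (Z : open_proper_families X T) : homset T (hausdorff_space_of d_le1) :=
  HB.pack_for (continuousType T (hyperspace d_le1)) (family_fiber d_le1 Z)
    (isContinuous.Build _ _ _ (family_fiber_continuous d_le1 Z)).
exists classify => [f|Z].
  apply/continuousEP => t; apply: hyperspace_eq.
  exact: (family_fiberE d_le1 (psh_map f taut) t).
case: Z => Z fZ; apply: eq_exist; apply/seteqP.
by split=> -[t x] /=; rewrite /pullback /tautological_family /= family_fiberE.
Qed.
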